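(* Let $\mathcal{A}\in\mathbb{C}^{m\times n\times r}$, $\mathcal{B}\in\mathbb{C}^{h\times k\times r}$, $\mathcal{C}\in\mathbb{C}^{a\times b\times r}$, $\mathcal{D}\in\mathbb{C}^{l\times d\times r}$ be given tensors. If the system $\mathcal{A}\ltimes X=\mathcal{B}$, $X\ltimes\mathcal{C}=\mathcal{D}$ has a solution $X\in\mathbb{C}^{p\times q}$, where $m\neq h$ and $l\neq p$, then $\mathcal{B}$ and $\mathcal{D}$ can be written in the block-wise forms $$\mathcal{B}=\begin{bmatrix}\operatorname{Block}_{11}(\mathcal{B})&\cdots&\operatorname{Block}_{1q}(\mathcal{B})\\ \vdots&\ddots&\vdots\\ \operatorname{Block}_{m1}(\mathcal{B})&\cdots&\operatorname{Block}_{mq}(\mathcal{B})\end{bmatrix},\qquad \mathcal{D}=\begin{bmatrix}\operatorname{Block}_{11}(\mathcal{D})&\cdots&\operatorname{Block}_{1b}(\mathcal{D})\\ \vdots&\ddots&\vdots\\ \operatorname{Block}_{p1}(\mathcal{D})&\cdots&\operatorname{Block}_{pb}(\mathcal{D})\end{bmatrix},$$ where, with $\beta=\frac{l}{p}$, all blocks $\operatorname{Block}_{sj}(\mathcal{B})\in\mathbb{C}^{\frac{h}{m}\times\frac{k}{q}\times r}$ and $\operatorname{Block}_{gt}(\mathcal{D})\in\mathbb{C}^{\beta\times\frac{d}{b}\times r}$ are Toeplitz tensors, for $s=1,\dots,m$, $j=1,\dots,q$, $g=1,\dots,p$, $t=1,\dots,b$.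
   Context: Tensors are third-order arrays over $\mathbb{C}$, with all dimensions positive integers. A matrix in $\mathbb{C}^{p\times q}$ is regarded as a $p\times q\times 1$ tensor. An equality of tensors means that both the sizes and all entries agree. Block forms partition the first two indices into consecutive intervals of equal lengths, keeping the full third index. A third-order tensor is a Toeplitz tensor if every frontal slice (third index fixed) is a Toeplitz matrix, i.e. its entries $a_{i_1,i_2,i_3}$ depend only on $i_1-i_2$ and $i_3$. $[x,y]$ denotes the least common multiple. $I_{n\times n\times k}$ is the identity tensor: its first frontal slice is the $n\times n$ identity matrix and its other frontal slices are zero. The Kronecker product of $\mathcal{A}\in\mathbb{C}^{n_1\times n_2\times n_3}$ and $\mathcal{B}\in\mathbb{C}^{p_1\times p_2\times p_3}$ is the $n_1p_1\times n_2p_2\times n_3p_3$ tensor whose entry at position $((i_1-1)p_1+j_1,(i_2-1)p_2+j_2,(i_3-1)p_3+j_3)$ is $a_{i_1i_2i_3}b_{j_1j_2j_3}$. The t-product of $\mathcal{A}\in\mathbb{C}^{m\times n\times r}$ and $\mathcal{B}\in\mathbb{C}^{n\times s\times r}$ is $\mathcal{A}*\mathcal{B}\in\mathbb{C}^{m\times s\times r}$ whose $k$-th frontal slice is $\sum_{i+j\equiv k+1\ (\mathrm{mod}\ r)}\mathcal{A}_{(::i)}\mathcal{B}_{(::j)}$ (sum over $1\le i,j\le r$). The semi-tensor product of $\mathcal{A}\in\mathbb{C}^{m\times n\times r}$ and $\mathcal{B}\in\mathbb{C}^{p\times q\times s}$ is $\mathcal{A}\ltimes\mathcal{B}=(\mathcal{A}\otimes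 I_{\frac{t}{n}\times\frac{t}{n}\times\frac{e}{r}})*(\mathcal{B}\otimes I_{\frac{t}{p}\times\frac{t}{p}\times\frac{e}{s}})\in\mathbb{C}^{\frac{mt}{n}\times\frac{qt}{p}\times e}$, where $t=[n,p]$ and $e=[r,s]$. (Existence of a solution forces $\frac{h}{m},\frac{k}{q},\frac{l}{p},\frac{d}{b}$ to be positive integers.) *)

(* Defs.v *)
From mathcomp Require Import all_boot all_order all_algebra.
From mathcomp Require Import reals.
From mathcomp Require Export complex mxtens.

Set Implicit Arguments.
Unset Strict Implicit.
Unset Printing Implicit Defensive.

Import GRing.Theory.
Local Open Scope ring_scope.

(* [A k] is the frontal slice of [A] of index [k], so that the entry of [A] in
   position (i1, i2, i3) is [A i3 i1 i2]; all indices start at 0. *)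
Definition tensor (T : Type) (n1 n2 n3 : nat) : Type :=
  {ffun 'I_n3 -> 'M[T]_(n1, n2)}.

(* Equality of tensors whose sizes need not be convertible. *)
Definition teq (T : Type) (n1 n2 n3 p1 p2 p3 : nat)
    (A : tensor T n1 n2 n3) (B : tensor T p1 p2 p3) : Prop :=
  [/\ n1 = p1, n2 = p2, n3 = p3 &
      forall (i1 : 'I_n1) (i2 : 'I_n2) (i3 : 'I_n3)
             (j1 : 'I_p1) (j2 : 'I_p2) (j3 : 'I_p3),
        i1 = j1 :> nat -> i2 = j2 :> nat -> i3 = j3 :> nat ->
        A i3 i1 i2 = B j3 j1 j2].

Notation "A =t B" := (teq A B) (at level 70, no associativity).

Definition tcast (T : Type) (n1 n2 n3 p1 p2 p3 : nat)
    (e1 : n1 = p1) (e2 : n2 = p2) (e3 : n3 = p3)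
    (A : tensor T n1 n2 n3) : tensor T p1 p2 p3 :=
  [ffun k => castmx (e1, e2) (A (cast_ord (esym e3) k))].

Definition tensor_of_mx (T : Type) (p q : nat) (X : 'M[T]_(p, q)) :
    tensor T p q 1 :=
  [ffun=> X].

Definition toeplitz_mx (T : Type) (p q : nat) (M : 'M[T]_(p, q)) : Prop :=
  forall (i i' : 'I_p) (j j' : 'I_q),
    i%:Z - j%:Z = i'%:Z - j'%:Z -> M i j = M i' j'.

Definition toeplitz_tensor (T : Type) (n1 n2 n3 : nat)
    (A : tensor T n1 n2 n3) : Prop :=
  forall k : 'I_n3, toeplitz_mx (A k).

(* [Block s j] occupies the rows s u, ..., s u + u - 1 and the columns
   j v, ..., j v + v - 1; the size \sum_(s < m) u is equal, but not
   convertible, to m * u. *)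
Definition tblock (T : Type) (m q u v r : nat)
    (Block : 'I_m -> 'I_q -> tensor T u v r) :
    tensor T (\sum_(s < m) u) (\sum_(j < q) v) r :=
  [ffun k => \mxblock_(s < m, j < q) (Block s j k)].

Section TensorProducts.

Variable R : pzRingType.

Definition id_tensor (n k : nat) : tensor R n n k :=
  [ffun l : 'I_k => if l == 0%N :> nat then 1%:M else 0].

(* [mxtens_unindex] is the inverse of (i, j) |-> i * p + j. *)
Definition kron (n1 n2 n3 p1 p2 p3 : nat)
    (A : tensor R n1 n2 n3) (B : tensor R p1 p2 p3) :
    tensor R (n1 * p1) (n2 * p2) (n3 * p3) :=
  [ffun k => tensmx (A (mxtens_unindex k).1) (B (mxtens_unindex k).2)].

(* With indices starting at 0, i + j = k + 1 [mod r] becomes i + j = k. *)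
Definition tprod (m n s r : nat)
    (A : tensor R m n r) (B : tensor R n s r) : tensor R m s r :=
  [ffun k : 'I_r =>
     \sum_(i < r) \sum_(j < r | (i + j == k %[mod r])%N) A i *m B j].

Lemma mul_lcm_divl (n p : nat) : (n * (lcmn n p %/ n) = lcmn n p)%N.
Proof. by rewrite mulnC divnK // dvdn_lcml. Qed.

Lemma mul_lcm_divr (n p : nat) : (p * (lcmn n p %/ p) = lcmn n p)%N.
Proof. by rewrite mulnC divnK // dvdn_lcmr. Qed.

Definition stprod (m n r p q s : nat)
    (A : tensor R m n r) (B : tensor R p q s) :
    tensor R (m * (lcmn n p %/ n)) (q * (lcmn n p %/ p)) (lcmn r s) :=
  let t := lcmn n p in
  let e := lcmn r s in
  tprod
    (tcast (erefl _) (mul_lcm_divl n p) (mul_lcm_divl r s)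
       (kron A (id_tensor (t %/ n) (e %/ r))))
    (tcast (mul_lcm_divr n p) (erefl _) (mul_lcm_divr r s)
       (kron B (id_tensor (t %/ p) (e %/ s)))).

End TensorProducts.

Notation "A ⋉ B" := (stprod A B) (at level 40, left associativity).

(* Main.v *)
Require Import Defs.
From mathcomp Require Import all_boot all_order all_algebra reals.
From mathcomp Require Import zify.

(** Put u = t/n and v = t/p.  Every frontal slice of a semi-tensor product is a
    sum of matrices (M ⊗ I_u)(N ⊗ I_v), whose entry in row s u + i and column
    j v + i' is the sum of the M_(s, α) N_(γ, j) over the pairs (α, γ) such that
    α u + i = γ v + i'.  For fixed s and j this condition only involves i - i',
    so that all the u × v blocks are Toeplitz. *)

Import GRing.Theory.
Local Open Scope ring_scope.

(** Equal quotients place the two entries in the same block, and [x + y' = x' + y] is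
    [x - y = x' - y'] without subtraction. Only the values of the indices occur, so the property is
    insensitive to casts of the sizes. *)
Definition block_toeplitz (T : Type) (h k u v : nat) (M : 'M[T]_(h, k)) : Prop :=
  forall (x x' : 'I_h) (y y' : 'I_k),
    (x %/ u = x' %/ u)%N -> (y %/ v = y' %/ v)%N -> (x + y' = x' + y)%N ->
    M x y = M x' y'.
Arguments block_toeplitz {T h k} u v M.

Lemma block_toeplitz0 (R : pzRingType) (h k u v : nat) :
  block_toeplitz u v (0 : 'M[R]_(h, k)).
Proof. by move=> x x' y y' _ _ _; rewrite !mxE. Qed.

Lemma block_toeplitz_sum (R : pzRingType) (h k u v : nat) (I : Type)
    (s : seq I) (P : pred I) (F : I -> 'M[R]_(h, k)) :
  (forall i, block_toeplitz u v (F i)) ->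
  block_toeplitz u v (\sum_(i <- s | P i) F i).
Proof.
move=> FP x x' y y' xx' yy' xy; rewrite !summxE.
by apply: eq_bigr => i _; exact: FP.
Qed.

(** By uniqueness of Euclidean division, [c = g * u + i] with [i < u] forces [g = c %/ u], so at
    most one term survives. *)
Lemma sum_mxtens_index (V : nmodType) (n u : nat) (f : 'I_n -> V) (c : 'I_(n * u))
    (i : nat) : (i < u)%N ->
  \sum_(g < n) f g *+ (c == g * u + i :> nat)%N =
  f (mxtens_unindex c).1 *+ (c %% u == i)%N.
Proof.
move=> iu; have u0 : (0 < u)%N by exact: leq_ltn_trans iu.
have eqE (g : nat) : (c == g * u + i :> nat)%N = (c %/ u == g)%N && (c %% u == i)%N.
  apply/eqP/andP => [-> | [/eqP <- /eqP <-]]; last exact: divn_eq.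
  by rewrite divnMDl// modnMDl divn_small// modn_small// addn0.
rewrite (bigD1 (mxtens_unindex c).1)//= big1 ?addr0 ?eqE ?eqxx// => g gc.
by rewrite eqE; case: eqP => // cg; case/eqP: gc; apply: val_inj.
Qed.

(** The two factors split the summation index in different ways, as [n * u] and as [p * v]. Turning
    each identity matrix into an indicator on the common index [c : 'I_t] removes the casts and
    makes them comparable. *)
Lemma tensmx1_rowE (R : pzRingType) (m n u t : nat) (e : (n * u)%N = t)
    (M : 'M[R]_(m, n)) (x : 'I_(m * u)) (c : 'I_t) :
  castmx (erefl _, e) (tensmx M (1%:M : 'M_u)) x c =
  \sum_(g < n) M (mxtens_unindex x).1 g *+ (c == g * u + x %% u :> nat)%N.
Proof.
case: t / e c => c; rewrite castmx_id sum_mxtens_index; last exact: mxtens_index_proof2.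
by rewrite !mxE -val_eqE/= mulr_natr eq_sym.
Qed.

Lemma tensmx1_colE (R : pzRingType) (p q v t : nat) (e : (p * v)%N = t)
    (N : 'M[R]_(p, q)) (c : 'I_t) (y : 'I_(q * v)) :
  castmx (e, erefl _) (tensmx N (1%:M : 'M_v)) c y =
  \sum_(g < p) N g (mxtens_unindex y).1 *+ (c == g * v + y %% v :> nat)%N.
Proof.
case: t / e c => c; rewrite castmx_id.
rewrite (sum_mxtens_index _ _ _ (fun g => N g _)); last exact: mxtens_index_proof2.
by rewrite !mxE -val_eqE/= mulr_natr.
Qed.

(** For fixed [i] only [c = a i] contributes. A bound on [a] alone suffices: if [b j] is at least
    [t], both sides give zero for that [j]. *)
Lemma sum_mul_indicator (R : pzRingType) (I J : finType) (t : nat)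
    (f : I -> R) (g : J -> R) (a : I -> nat) (b : J -> nat) :
  (forall i, a i < t)%N ->
  \sum_(c < t) (\sum_i f i *+ (c == a i :> nat)) * (\sum_j g j *+ (c == b j :> nat)) =
  \sum_i \sum_j (f i * g j) *+ (a i == b j).
Proof.
move=> at_lt; under eq_bigr do rewrite mulr_suml.
rewrite exchange_big/=; apply: eq_bigr => i _.
rewrite (bigD1 (Ordinal (at_lt i)))//= [X in _ + X]big1 => [|c ca]; last first.
  by rewrite (_ : (c == a i :> nat) = false) ?mulr0n ?mul0r//; exact: negbTE.
rewrite eqxx addr0 mulr_sumr.
by apply: eq_bigr => j _; rewrite mulrnAr.
Qed.

Lemma block_toeplitz_tensmx1 (R : pzRingType) (m n p q u v t : nat)
    (em : (n * u)%N = t) (ep : (p * v)%N = t) (M : 'M[R]_(m, n)) (N : 'M[R]_(p, q)) :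
  block_toeplitz u v
    (castmx (erefl _, em) (tensmx M (1%:M : 'M_u)) *m
     castmx (ep, erefl _) (tensmx N (1%:M : 'M_v))).
Proof.
have mulE x y : (castmx (erefl _, em) (tensmx M (1%:M : 'M_u)) *m
     castmx (ep, erefl _) (tensmx N (1%:M : 'M_v))) x y =
  \sum_(i < n) \sum_(j < p) (M (mxtens_unindex x).1 i * N j (mxtens_unindex y).1)
     *+ (i * u + x %% u == j * v + y %% v)%N.
  rewrite mxE -(@sum_mul_indicator _ _ _ t _ _ _ (fun j : 'I_p => j * v + y %% v)%N).
    by apply: eq_bigr => c _; rewrite tensmx1_rowE tensmx1_colE.
  by move=> i; rewrite -em (mxtens_index_proof (i, (mxtens_unindex x).2)).
move=> x x' y y' xx' yy' xy; rewrite !mulE.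
rewrite (_ : (mxtens_unindex x).1 = (mxtens_unindex x').1); last exact: val_inj.
rewrite (_ : (mxtens_unindex y).1 = (mxtens_unindex y').1); last exact: val_inj.
apply: eq_bigr => i _; apply: eq_bigr => j _; congr (_ *+ _).
(* Cancelling the equal quotients in [xy] leaves a relation between remainders, which makes the two
   index conditions equivalent. With the products taken as atoms, this is linear. *)
move: xy (divn_eq x u) (divn_eq x' u) (divn_eq y v) (divn_eq y' v).
rewrite xx' yy'; clear.
move: (x %% u)%N (x' %% u)%N (y %% v)%N (y' %% v)%N.
move: (x' %/ u * u)%N (y' %/ v * v)%N (i * u)%N (j * v)%N.
by lia.
Qed.

Lemma block_toeplitz_stprod (R : pzRingType) (m n r p q s : nat)
    (A : tensor R m n r) (B : tensor R p q s) (k : 'I_(lcmn r s)) :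
  block_toeplitz (lcmn n p %/ n) (lcmn n p %/ p) ((A ⋉ B) k).
Proof.
rewrite /stprod /tprod ffunE; apply: block_toeplitz_sum => i.
apply: block_toeplitz_sum => j; rewrite !ffunE.
(* A slice of an identity tensor is the identity matrix or zero, and a zero slice kills the
   summand. *)
case: ifP => _; last by rewrite tensmx0 castmx_const mul0mx; exact: block_toeplitz0.
case: ifP => _; last by rewrite tensmx0 castmx_const mulmx0; exact: block_toeplitz0.
exact: block_toeplitz_tensmx1.
Qed.

(** All blocks before the current one have size [u]. This matches the indexing of [\mxblock] with
    that of [mxtens_index]. *)
Lemma val_sig_const (m u : nat) (i : 'I_(\sum_(s < m) u)) :
  i = (tagnat.sig1 i * u + tagnat.sig2 i)%N :> nat.
Proof.
rewrite {1}[i : nat]tagnat.rect -(big_ord_widen _ (fun=> u)); last exact: ltnW.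
by rewrite sum_nat_const card_ord.
Qed.

Lemma teq_tblock (T : Type) (m q u v h k r : nat) (B : tensor T h k r) :
  h = (m * u)%N -> k = (q * v)%N -> (forall l, block_toeplitz u v (B l)) ->
  exists Block : 'I_m -> 'I_q -> tensor T u v r,
    B =t tblock Block /\ forall s j, toeplitz_tensor (Block s j).
Proof.
move=> hE kE; move: B; rewrite hE kE {h k hE kE} => B BP.
exists (fun s j => [ffun l => \matrix_(i, i')
   B l (mxtens_index (s, i)) (mxtens_index (j, i'))]); split.
  split; rewrite ?sum_nat_const ?card_ord// => x y l x' y' l' xx' yy' ll'.
  rewrite !ffunE !mxE (val_inj ll').
  by rewrite !ffunE !mxE; congr (B _ _ _); apply: val_inj; rewrite /= -val_sig_const.
move=> s j l i i' y y' e; rewrite !ffunE !mxE; apply: BP => /=.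
(* The existence of an index in ['I_u] gives [0 < u], so [s * u + i] has quotient [s]. *)
- have u0 := leq_ltn_trans (leq0n _) (ltn_ord i).
  by rewrite !divnMDl// !divn_small.
- have v0 := leq_ltn_trans (leq0n _) (ltn_ord y).
  by rewrite !divnMDl// !divn_small.
- lia.
Qed.

(** The third sizes [r] and [s] are independent, so that the matrix [X] can be either factor and
    both equations of the system are covered. *)
Lemma stprod_teq_tblock (R : pzRingType) (m n r p q s h k r' : nat)
    (A : tensor R m n r) (B : tensor R p q s) (D : tensor R h k r') :
  (0 < m)%N -> (0 < q)%N -> A ⋉ B =t D ->
  [/\ (m %| h)%N, (q %| k)%N &
      exists Block : 'I_m -> 'I_q -> tensor R (h %/ m) (k %/ q) r',
        D =t tblock Block /\ forall s j, toeplitz_tensor (Block s j)].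
Proof.
move=> m0 q0 [hE kE rE ABD]; split; rewrite -?hE -?kE ?dvdn_mulr//.
case: h / hE in D ABD *; case: k / kE in D ABD *; case: r' / rE in D ABD *.
(* As [m] and [q] are positive, the quotients [h %/ m] and [k %/ q] are exactly the block sizes
   [t/n] and [t/p]. *)
rewrite !mulKn//; apply: teq_tblock => // l x x' y y' xx' yy' xy.
rewrite -(ABD x y l)// -(ABD x' y' l)//.
exact: block_toeplitz_stprod xx' yy' xy.
Qed.

Theorem theorem4p8 (R : realType) (m n r h k a b l d p q : nat)
  (m0 : (0 < m)%N) (n0 : (0 < n)%N) (r0 : (0 < r)%N) (h0 : (0 < h)%N)
  (k0 : (0 < k)%N) (a0 : (0 < a)%N) (b0 : (0 < b)%N) (l0 : (0 < l)%N)
  (d0 : (0 < d)%N) (p0 : (0 < p)%N) (q0 : (0 < q)%N)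
  (A : tensor R[i] m n r) (B : tensor R[i] h k r)
  (C : tensor R[i] a b r) (D : tensor R[i] l d r)
  (mh : m <> h) (lp : l <> p)
  (solvable : exists X : 'M[R[i]]_(p, q),
     A ⋉ tensor_of_mx X =t B /\ tensor_of_mx X ⋉ C =t D) :
  [/\ [/\ (m %| h)%N, (q %| k)%N, (p %| l)%N & (b %| d)%N],
      exists BlockB : 'I_m -> 'I_q -> tensor R[i] (h %/ m) (k %/ q) r,
        B =t tblock BlockB /\ forall s j, toeplitz_tensor (BlockB s j) &
      exists BlockD : 'I_p -> 'I_b -> tensor R[i] (l %/ p) (d %/ b) r,
        D =t tblock BlockD /\ forall g t, toeplitz_tensor (BlockD g t)].
Proof.
case: solvable => X [/stprod_teq_tblock [//|//|mh' qk BB]].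
by case/stprod_teq_tblock => // pl bd BD; split.
Qed.
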